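(* Let $\Omega \subset \mathbb{R}^n$ be an open, connected, bounded set. Let $\mathbf{X}_t$ be the $n$-dimensional It\^{o} process $\mathrm d\mathbf{X}_t = \boldsymbol{\mu}(\mathbf{X}_t,t)\,\mathrm dt + \boldsymbol{\sigma}(\mathbf{X}_t,t)\,\mathrm d\mathbf{W}_t$, and let $\mathbf{X}_t^\Omega$ be this process started at a given $\mathbf{x}_0 \in \Omega$ and killed at $\partial\Omega$ at some random time $\mathcal{T}$ and random location $\mathcal{Y} \in \partial\Omega$ (the first exit time from $\Omega$ and the first exit location). Let $\mathbb{E}_{\mathbf{X}^\Omega}\{\,\cdot\,\}$ denote the expectation under the law of $\mathbf{X}_t^\Omega$. For a function $g(\mathbf{x},t)$, let $$G = \int_0^{\mathcal{T}} g(\mathbf{X}^\Omega_t, t)\,\mathrm dt .$$ Then, whenever $g\, f^{\Omega}_{\mathrm{bridge}}$ allows the exchange of integration and expectation, $$\mathbb{E}_{\mathbf{X}^\Omega}\{G\} = \mathbb{E}_{\mathbf{X}^\Omega}\left\{ \int_0^{\mathcal{T}} \left( \int_{\Omega} g(\mathbf{x},t)\, f^{\Omega}_{\mathrm{bridge}}(\mathbf{x},t;\mathbf{x}_0,\mathbf{x}_T\to\mathcal{Y},\mathcal{T})\,\mathrm d\mathbf{x} \right)\mathrm dt \right\},$$ where $f^{\Omega}_{\mathrm{bridge}}(\mathbf{x},t;\mathbf{x}_0,\mathbf{x}_T\to\mathbf{y},T)$ denotes the limit, as $\mathbf{x}_T\in\Omega$ tends to $\mathbf{y}\in\partial\Omega$,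 of the confined bridge density $f^{\Omega}_{\mathrm{bridge}}(\mathbf{x},t;\mathbf{x}_0,\mathbf{x}_T,T)$, and in the right-hand side this limit is evaluated at the random exit pair $(\mathbf{y},T)=(\mathcal{Y},\mathcal{T})$.
   Context: Process: $\mathbf{W}_t$ is a $k$-dimensional Wiener process, $\boldsymbol{\mu}:\mathbb{R}^n\times\mathbb{R}_{\ge 0}\to\mathbb{R}^n$ is the drift, $\boldsymbol{\sigma}:\mathbb{R}^n\times\mathbb{R}_{\ge 0}\to\mathbb{R}^{n\times k}$, and $\mathbf{D}=\frac12\boldsymbol{\sigma}\boldsymbol{\sigma}^\top$ is the diffusion tensor, with entries $D_{ij}(\mathbf{x},t)$. The infinitesimal generator and its $L^2$ adjoint are $$\mathcal{A}f=\sum_i \mu_i\frac{\partial f}{\partial x_i}+\sum_{i,j}D_{ij}\frac{\partial^2 f}{\partial x_i\partial x_j},\qquad \mathcal{A}^*f=-\sum_i\frac{\partial(\mu_i f)}{\partial x_i}+\sum_{i,j}\frac{\partial^2(D_{ij}f)}{\partial x_i\partial x_j}.$$ Forward Kolmogorov problem: for $\mathbf{x}_0\in\Omega$, $f^{\mathrm F}(\mathbf{x},t;\mathbf{x}_0,0)$ is the solution of $\partial_t f^{\mathrm F}=\mathcal{A}^*f^{\mathrm F}$ in $\Omega$, with initial condition $f^{\mathrm F}(\mathbf{x},0)=\delta(\mathbf{x}-\mathbf{x}_0)$ and $f^{\mathrm F}(\mathbf{x},t)=0$ for $\mathbf{x}\in\partial\Omega$. Backward Kolmogorov problem: for $\mathbf{x}_T\in\Omega$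 and $T>0$, $f^{\mathrm B}(\mathbf{x},t;\mathbf{x}_T,T)$, $t\le T$, is the solution of $\partial_t f^{\mathrm B}=-\mathcal{A}f^{\mathrm B}$ in $\Omega$, with final condition $f^{\mathrm B}(\mathbf{x},T)=\delta(\mathbf{x}-\mathbf{x}_T)$ and $f^{\mathrm B}(\mathbf{x},t)=0$ for $\mathbf{x}\in\partial\Omega$. Confined stochastic bridge: for $\mathbf{x}_0,\mathbf{x}_T\in\Omega$ and $T>0$, the process $\mathbf{X}_t$ conditioned to start at $\mathbf{x}_0$ at time $0$, to be at $\mathbf{x}_T$ at time $T$, and to stay in $\Omega$ for all $t\in(0,T)$ has density at $\mathbf{x}\in\Omega$, $t\in(0,T)$, $$f^{\Omega}_{\mathrm{bridge}}(\mathbf{x},t;\mathbf{x}_0,\mathbf{x}_T,T)=\frac{f^{\mathrm F}(\mathbf{x},t;\mathbf{x}_0,0)\,f^{\mathrm B}(\mathbf{x},t;\mathbf{x}_T,T)}{f^{\mathrm F}(\mathbf{x}_T,T;\mathbf{x}_0,0)}.$$ Standing premises: the Kolmogorov problems above are solvable, with $f^{\mathrm F}$ and $f^{\mathrm B}$ the forward and backward transition densities of the process killed at $\partial\Omega$. As $\mathbf{x}_T\to\mathbf{y}\in\partial\Omega$, the bridge density converges, and its limit $f^{\Omega}_{\mathrm{bridge}}(\mathbf{x},t;\mathbf{x}_0,\mathbf{x}_T\to\mathbf{y},T)$ is, for $t\in(0,T)$, the density at time $t$ of the killed process $\mathbf{X}^\Omega_t$ conditioned to first exit $\Omega$ at time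 $T$ and location $\mathbf{y}$, i.e. conditioned on $\mathcal{Y}=\mathbf{y}$, $\mathcal{T}=T$. The function $g$ is such that the integrals $\int_\Omega g\,f^{\Omega}_{\mathrm{bridge}}\,\mathrm d\mathbf{x}$ are finite. ''Allows the exchange of integration and expectation'' means that the order of the time integral, the spatial integral against the bridge density, and the (conditional) expectation may be interchanged, as in Fubini's theorem. *)

(* Defs.v *)
From HB Require Import structures.
From mathcomp Require Import all_boot all_order all_algebra.
From mathcomp Require Import all_classical all_reals all_analysis.
From mathcomp Require Import measurable_realfun.

Set Implicit Arguments.
Unset Strict Implicit.
Unset Printing Implicit Defensive.

Import Order.TTheory GRing.Theory Num.Theory.
Import numFieldNormedType.Exports.

Local Open Scope classical_set_scope.
Local Open Scope ring_scope.

(* R^n is 'rV[R]_n.  Its sigma-algebra is the one generated by the coordinates,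
   as for n.-tuple; for R^n it is the Borel sigma-algebra. *)
Definition measure_rV_display : measure_display.
Proof. exact: default_measure_display. Qed.

Section measurable_rV.
Variables (R : realType) (n : nat).

Definition rV_coord (i : 'I_n) (v : 'rV[R]_n) : R := v ord0 i.

Let rV_set0 : g_sigma_preimage rV_coord set0.
Proof. exact: sigma_algebra0. Qed.

Let rV_setC A : g_sigma_preimage rV_coord A -> g_sigma_preimage rV_coord (~` A).
Proof. exact: sigma_algebraC. Qed.

Let rV_bigcup (F : _^nat) : (forall i, g_sigma_preimage rV_coord (F i)) ->
  g_sigma_preimage rV_coord (\bigcup_i (F i)).
Proof. exact: sigma_algebra_bigcup. Qed.

HB.instance Definition _ := @isMeasurable.Build measure_rV_display
  'rV[R]_n (g_sigma_preimage rV_coord) rV_set0 rV_setC rV_bigcup.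

End measurable_rV.

Lemma measurable_rV_coord (R : realType) n (i : 'I_n) :
  measurable_fun [set: 'rV[R]_n] (rV_coord i).
Proof.
move=> _ Y mY; rewrite setTI; apply: sub_sigma_algebra => /=.
rewrite -bigcup_seq/=; exists i => /=; first by rewrite mem_index_enum.
by exists Y => //; rewrite setTI.
Qed.

Lemma measurable_fun_rV d (T : measurableType d) (R : realType) n
    (f : T -> 'rV[R]_n) :
  (forall i, measurable_fun [set: T] (fun x => f x ord0 i)) ->
  measurable_fun [set: T] f.
Proof.
move=> mf; have : g_sigma_preimage (fun i => @rV_coord R n i \o f) `<=` measurable.
  apply: smallest_sub; first exact: sigma_algebra_measurable.
  move=> A; rewrite -bigcup_seq/= => -[i _ [B mB <-]].
  exact: mf.
rewrite g_sigma_preimage_comp => S _ A mA.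
by apply: S; exists A.
Qed.

(* m1 \x m2 as a sigma-finite measure: the canonical instance inferred for
   product_measure1 only covers subprobability measures. *)
Section prod_measure.
Context d1 d2 (T1 : measurableType d1) (T2 : measurableType d2) (R : realType).
Variables (m1 : {sigma_finite_measure set T1 -> \bar R})
  (m2 : {sigma_finite_measure set T2 -> \bar R}).

Definition prod_measure : set (T1 * T2) -> \bar R := (m1 \x m2)%E.

HB.instance Definition _ := Measure.on prod_measure.

Let prod_measure_sigma_finite : sigma_finite setT prod_measure.
Proof.
have /sigma_finiteP[F [TF ndF Foo]] := sigma_finiteT m1.
have /sigma_finiteP[G [TG ndG Goo]] := sigma_finiteT m2.
exists (fun n => F n `*` G n).
  rewrite -setXTT TF TG predeqE => -[x y]; split.
    move=> [/= [n _ Fnx] [k _ Gky]]; exists (maxn n k) => //; split.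
    - by move: x Fnx; exact/subsetPset/ndF/leq_maxl.
    - by move: y Gky; exact/subsetPset/ndG/leq_maxr.
  by move=> [n _ []/= ? ?]; split; exists n.
move=> k; have [? ?] := Foo k; have [? ?] := Goo k.
split; first exact: measurableX.
by rewrite /prod_measure product_measure1E// lte_mul_pinfty// ge0_fin_numE.
Qed.

HB.instance Definition _ :=
  Measure_isSigmaFinite.Build _ _ _ prod_measure prod_measure_sigma_finite.

End prod_measure.

Section lebesgue_rV.
Variable R : realType.

Definition rV_cons n (p : R * 'rV[R]_n) : 'rV[R]_n.+1 :=
  \row_(j < n.+1) if unlift ord0 j is Some i then p.2 ord0 i else p.1.

Definition rV_uncons n (v : 'rV[R]_n.+1) : R * 'rV[R]_n :=
  (v ord0 ord0, \row_(i < n) v ord0 (lift ord0 i)).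

Lemma rV_consK n : cancel (@rV_cons n) (@rV_uncons n).
Proof.
move=> [x v]; rewrite /rV_uncons mxE unlift_none; congr (_, _).
by apply/rowP => i; rewrite !mxE liftK.
Qed.

Lemma measurable_rV_cons n : measurable_fun [set: R * 'rV[R]_n] (@rV_cons n).
Proof.
apply: measurable_fun_rV => j.
rewrite (_ : (fun _ => _) = fun p : R * 'rV[R]_n =>
   if unlift ord0 j is Some i then rV_coord i p.2 else p.1).
  case: (unlift ord0 j) => [i|]; last exact: measurable_fst.
  apply: (measurableT_comp (@measurable_rV_coord R n i)) => //.
by apply/funext => p; rewrite mxE.
Qed.

Lemma measurable_rV_uncons n :
  measurable_fun [set: 'rV[R]_n.+1] (@rV_uncons n).
Proof.
apply/measurable_fun_pair; first exact: measurable_rV_coord.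
apply: measurable_fun_rV => i.
rewrite (_ : (fun _ => _) = @rV_coord R n.+1 (lift ord0 i)).
  exact: measurable_rV_coord.
by apply/funext => v; rewrite mxE.
Qed.

Section step.
Variables (n : nat) (m : {sigma_finite_measure set 'rV[R]_n -> \bar R}).

Definition lebesgue_rV_step : set 'rV[R]_n.+1 -> \bar R :=
  pushforward (prod_measure lebesgue_measure m) (@rV_cons n).

Let step_measure :
  exists mu : {measure set 'rV[R]_n.+1 -> \bar R}, mu = lebesgue_rV_step :> (_ -> _).
Proof.
have mc := @measurable_rV_cons n.
by exists (measure_function_pushforward__canonical__measure_function_Measure
  (prod_measure lebesgue_measure m) mc).
Qed.

Let step0 : (lebesgue_rV_step set0 = 0)%E.
Proof. by have [mu_ <-] := step_measure; exact: measure0. Qed.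

Let step_ge0 A : (0 <= lebesgue_rV_step A)%E.
Proof.
by have [mu_ <-] := step_measure; exact: measure_ge0.
Qed.

Let step_sigma : semi_sigma_additive lebesgue_rV_step.
Proof. 
by have [mu_ <-] := step_measure; exact: measure_semi_sigma_additive.
Qed.

HB.instance Definition _ := isMeasure.Build _ _ _ lebesgue_rV_step
  step0 step_ge0 step_sigma.

Let step_sigma_finite : sigma_finite setT lebesgue_rV_step.
Proof.
have [F FT mF] := sigma_finiteT (prod_measure lebesgue_measure m).
exists (fun k => @rV_uncons n @^-1` F k).
  by rewrite -preimage_bigcup -FT preimage_setT.
move=> k; have [mFk Fk] := mF k; split.
  by rewrite -[X in measurable X]setTI; exact: measurable_rV_uncons.
rewrite /lebesgue_rV_step /pushforward -comp_preimage.
rewrite (_ : _ \o _ = id) ?preimage_id//.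
by apply/funext => p /=; rewrite rV_consK.
Qed.

HB.instance Definition _ := Measure_isSigmaFinite.Build _ _ _ lebesgue_rV_step
  step_sigma_finite.

End step.

Fixpoint lebesgue_rV (n : nat) : {sigma_finite_measure set 'rV[R]_n -> \bar R} :=
  match n with
  | 0%N => @dirac _ 'rV[R]_0 0 R
  | n'.+1 => lebesgue_rV_step (lebesgue_rV n')
  end.

Lemma measurable_rV_box n (A : 'I_n -> set R) :
  (forall i, measurable (A i)) ->
  measurable [set v : 'rV[R]_n | forall i, A i (v ord0 i)].
Proof.
move=> mA.
rewrite (_ : [set _ | _] = \big[setI/setT]_(i < n) (@rV_coord R n i @^-1` A i)).
  apply: (big_ind (fun B : set 'rV[R]_n => measurable B)) => //; first exact: measurableI.
  by move=> i _; rewrite -[X in measurable X]setTI; exact: measurable_rV_coord.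
rewrite -bigcap_seq; apply/seteqP; split=> [v Av i _|v Av i]; first exact: Av.
by apply: Av; rewrite /= mem_index_enum.
Qed.

Lemma lebesgue_rV_box n (A : 'I_n -> set R) : (forall i, measurable (A i)) ->
  lebesgue_rV n [set v | forall i, A i (v ord0 i)] =
  (\prod_(i < n) lebesgue_measure (A i))%E.
Proof.
elim: n A => [|n IHn] A mA.
  by rewrite big_ord0 /= diracE mem_set// => -[].
rewrite big_ord_recl -IHn; last by move=> i; exact: mA.
rewrite /= /lebesgue_rV_step /pushforward.
rewrite [X in prod_measure _ _ X](_ : _ = A ord0 `*`
    [set v : 'rV[R]_n | forall i, A (lift ord0 i) (v ord0 i)]); last first.
  apply/seteqP; split=> [[x v] /= Av|[x v] /= [Ax Av] i].
    split=> [|i]; first by have := Av ord0; rewrite mxE unlift_none.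
    by have := Av (lift ord0 i); rewrite mxE liftK.
  by rewrite mxE; case: unliftP => [j ->|->].
rewrite /prod_measure product_measure1E; [by []|exact: mA|].
exact: (@measurable_rV_box n (fun i => A (lift ord0 i))).
Qed.

End lebesgue_rV.

Section stochastic_processes.
Context (R : realType) d (S : measurableType d) (P : probability S R).
Implicit Types (F : R -> set (set S)) (t : R).

Definition filtration F :=
  (forall t, 0 <= t -> sigma_algebra [set: S] (F t) /\ F t `<=` measurable) /\
  (forall s t, 0 <= s -> s <= t -> F s `<=` F t).

Definition measurable_wrt d' (E : measurableType d') (G : set (set S))
    (Y : S -> E) :=
  forall A, measurable A -> G (Y @^-1` A).

(* Standard Wiener process with respect to F: for s < t the increment is
   independent of F s, with independent components of law N(0, t - s). *)
Definition wiener_process k F (W : R -> S -> 'rV[R]_k) :=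
  [/\ forall w, W 0 w = 0,
      forall w, {within `[0, +oo[, continuous (W ^~ w)},
      forall t, 0 <= t -> measurable_wrt (F t) (W t) &
      forall s t (A : 'I_k -> set R) (B : set S), 0 <= s -> s < t ->
        (forall i, measurable (A i)) -> F s B ->
        P (B `&` [set w | forall i, A i (W t w ord0 i - W s w ord0 i)]) =
        (P B * \prod_(i < k) normal_prob 0 (Num.sqrt (t - s)) (A i))%E].

(* H_t(w) = sum_j coef_j(w) 1_(lo_j, hi_j](t) *)
Record simple_process F := SimpleProcess {
  sp_size : nat;
  sp_lo : 'I_sp_size -> R;
  sp_hi : 'I_sp_size -> R;
  sp_coef : 'I_sp_size -> S -> R;
  _ : forall j, 0 <= sp_lo j <= sp_hi j;
  _ : forall j, exists M, forall w, `|sp_coef j w| <= M;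
  _ : forall j, measurable_wrt (F (sp_lo j)) (sp_coef j) }.

Definition simple_value F (H : simple_process F) t w : R :=
  \sum_(j < sp_size H) sp_coef j w * ((sp_lo j < t) && (t <= sp_hi j))%:R.

Definition simple_integral F (H : simple_process F) (B : R -> S -> R) t w : R :=
  \sum_(j < sp_size H) sp_coef j w *
    (B (Num.min (sp_hi j) t) w - B (Num.min (sp_lo j) t) w).

Definition cvg0_in_probability (Y : nat -> S -> \bar R) :=
  forall e : R, 0 < e -> P [set w | (e%:E <= Y m w)%E] @[m --> \oo] --> 0%E.

(* I_t is the Ito integral of H against the scalar Wiener process B over [0, t]:
   the limit in probability of the integrals of simple processes H_m such that
   the integral of |H_m - H|^2 over [0, t] tends to 0 in probability. *)
Definition is_ito_integral F (B H I : R -> S -> R) :=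
  measurable_fun ([set t : R | 0 <= t] `*` [set: S]) (fun p : R * S => H p.1 p.2) /\
  exists Hm : nat -> simple_process F, forall t, 0 <= t ->
    cvg0_in_probability (fun m w => \int[lebesgue_measure]_(s in `[0%R, t])
      ((simple_value (Hm m) s w - H s w) ^+ 2)%:E)%E /\
    cvg0_in_probability (fun m w =>
      (`|simple_integral (Hm m) B t w - I t w|)%:E).

(* X is a solution of dX = mu(X, t) dt + sigma(X, t) dW with X_0 = x0. *)
Definition ito_process n k F (W : R -> S -> 'rV[R]_k)
    (mu : 'rV[R]_n -> R -> 'rV[R]_n) (sigma : 'rV[R]_n -> R -> 'M[R]_(n, k))
    (x0 : 'rV[R]_n) (X : R -> S -> 'rV[R]_n) :=
  [/\ forall w, X 0 w = x0,
      forall w, {within `[0, +oo[, continuous (X ^~ w)},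
      forall t, 0 <= t -> measurable_wrt (F t) (X t),
      forall i t, 0 <= t -> {ae P, forall w,
        lebesgue_measure.-integrable `[0, t]
          (fun s => (mu (X s w) s ord0 i)%:E)} &
      exists I : 'I_n -> 'I_k -> R -> S -> R,
        (forall i j, is_ito_integral F (fun s w => W s w ord0 j)
           (fun s w => sigma (X s w) s i j) (I i j)) /\
        (forall i t, 0 <= t -> {ae P, forall w,
           X t w ord0 i = x0 ord0 i +
             (\int[lebesgue_measure]_(s in `[0, t]) mu (X s w) s ord0 i) +
             \sum_(j < k) I i j t w})].

End stochastic_processes.

Definition boundary (R : realType) n (Om : set 'rV[R]_n) : set 'rV[R]_n :=
  closure Om `\` interior Om.

(* The killed process is X_t for t < exit_time; after that it is in the
   cemetery.  It is only ever used through the event alive and X. *)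
Section killing.
Context (R : realType) (n : nat) d (S : measurableType d).
Variables (Om : set 'rV[R]_n) (X : R -> S -> 'rV[R]_n).

Definition exit_time (w : S) : \bar R :=
  ereal_inf [set t%:E | t in [set t : R | 0 <= t /\ ~ Om (X t w)]].

Definition exit_location (w : S) : 'rV[R]_n := X (fine (exit_time w)) w.

Definition alive (t : R) : set S := [set w | (t%:E < exit_time w)%E].

Definition lifespan (w : S) : set R := [set t : R | 0 < t /\ alive t w].

End killing.

Section kolmogorov.
Context (R : realType) (n : nat).
Implicit Types (f : 'rV[R]_n -> R) (u : 'rV[R]_n -> R -> R).

Definition diffusion_tensor k (sigma : 'rV[R]_n -> R -> 'M[R]_(n, k))
    (x : 'rV[R]_n) (t : R) : 'M[R]_n :=
  2^-1 *: (sigma x t *m (sigma x t)^T).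

Definition evec (i : 'I_n) : 'rV[R]_n := delta_mx ord0 i.

Definition partial (i : 'I_n) f (x : 'rV[R]_n) : R := derive f x (evec i).

Definition partial2 (i j : 'I_n) f (x : 'rV[R]_n) : R :=
  partial i (partial j f) x.

Definition has_partial (i : 'I_n) f (x : 'rV[R]_n) : Prop :=
  derivable f x (evec i).

Definition has_partial2 (i j : 'I_n) f (x : 'rV[R]_n) : Prop :=
  has_partial i (partial j f) x.

Variables (mu : 'rV[R]_n -> R -> 'rV[R]_n) (D : 'rV[R]_n -> R -> 'M[R]_n).

Definition generator (t : R) f (x : 'rV[R]_n) : R :=
  \sum_(i < n) mu x t ord0 i * partial i f x +
  \sum_(i < n) \sum_(j < n) D x t i j * partial2 i j f x.

Definition generator_adj (t : R) f (x : 'rV[R]_n) : R :=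
  - (\sum_(i < n) partial i (fun z => mu z t ord0 i * f z) x) +
  \sum_(i < n) \sum_(j < n) partial2 i j (fun z => D z t i j * f z) x.

Variable Om : set 'rV[R]_n.

(* The delta function at a as initial or final condition: weak convergence of
   the measures u(x, t) dx on Om to the Dirac mass at a, as t tends to the
   initial or final time along G. *)
Definition tends_to_delta (G : set_system R) (a : 'rV[R]_n) u :=
  forall phi : 'rV[R]_n -> R, continuous phi ->
    (fun t => \int[lebesgue_rV R n]_(x in Om) (phi x * u x t)%:E)%E @ G
      --> (phi a)%:E.

Definition vanishes_on_boundary (J : set R) u :=
  forall t, J t -> {within closure Om, continuous (u ^~ t)} /\
    (forall x, boundary Om x -> u x t = 0).

Definition forward_solution (x0 : 'rV[R]_n) u :=
  [/\ forall x t, Om x -> 0 < t ->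
        [/\ derivable (u x) t 1,
            forall i, has_partial i (fun z => mu z t ord0 i * u z t) x,
            forall i j, has_partial j (fun z => D z t i j * u z t) x,
            forall i j, has_partial2 i j (fun z => D z t i j * u z t) x &
            derive1 (u x) t = generator_adj t (u ^~ t) x],
      tends_to_delta 0^'+ x0 u &
      vanishes_on_boundary `]0, +oo[ u].

Definition backward_solution (xT : 'rV[R]_n) (T : R) u :=
  [/\ forall x t, Om x -> 0 < t < T ->
        [/\ derivable (u x) t 1,
            forall i, has_partial i (u ^~ t) x,
            forall i j, has_partial2 i j (u ^~ t) x &
            derive1 (u x) t = - generator t (u ^~ t) x],
      tends_to_delta T^'- xT u &
      vanishes_on_boundary `]0, T[ u].

End kolmogorov.

Section densities.
Context (R : realType) (n : nat) d (S : measurableType d) (P : probability S R).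
Variables (F : R -> set (set S)) (Om : set 'rV[R]_n) (X : R -> S -> 'rV[R]_n).
Local Open Scope ereal_scope.

Definition nonneg_measurable_on (f : 'rV[R]_n -> R) :=
  measurable_fun Om f /\ (forall x, Om x -> (0 <= f x)%R).

(* f x t is the density at x of the killed process at time t. *)
Definition forward_transition_density (f : 'rV[R]_n -> R -> R) :=
  forall t : R, (0 < t)%R -> nonneg_measurable_on (f ^~ t) /\
    forall A : set 'rV[R]_n, measurable A ->
      P (alive Om X t `&` X t @^-1` A) =
      \int[lebesgue_rV R n]_(x in Om `&` A) (f x t)%:E.

(* f x t z T is the density at z of the killed process at time T, given that it
   is at x at time t: conditionally on F t, and on {alive at t}, the killed
   process at time T has density f (X_t) t _ T. *)
Definition backward_transition_density
    (f : 'rV[R]_n -> R -> 'rV[R]_n -> R -> R) :=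
  forall t T : R, (0 <= t)%R -> (t < T)%R ->
  [/\ forall x, Om x -> nonneg_measurable_on (fun z => f x t z T),
      forall A : set 'rV[R]_n, measurable A -> measurable_fun Om
        (fun x => \int[lebesgue_rV R n]_(z in Om `&` A) (f x t z T)%:E) &
      forall (A : set 'rV[R]_n) (B : set S), measurable A -> F t B ->
        P (B `&` alive Om X T `&` X T @^-1` A) =
        \int[P]_(w in B `&` alive Om X t)
          \int[lebesgue_rV R n]_(z in Om `&` A) (f (X t w) t z T)%:E].

(* f x y T is the density at x of the killed process at time t conditionally
   on the exit location being y and the exit time being T > t (a regular
   conditional density, in the sense of disintegration). *)
Definition density_given_exit (t : R) (f : 'rV[R]_n -> 'rV[R]_n -> R -> R) :=
  [/\ forall y (T : R), boundary Om y -> (t < T)%R ->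
        nonneg_measurable_on (fun x => f x y T),
      forall A : set 'rV[R]_n, measurable A ->
        measurable_fun [set u : 'rV[R]_n * R | boundary Om u.1 /\ (t < u.2)%R]
          (fun u => \int[lebesgue_rV R n]_(x in Om `&` A) (f x u.1 u.2)%:E) &
      forall (A : set 'rV[R]_n) (C : set ('rV[R]_n * R)),
        measurable A -> measurable C ->
        let exitC := [set w | C (exit_location Om X w, fine (exit_time Om X w))] in
        P (alive Om X t `&` exitC `&` X t @^-1` A) =
        \int[P]_(w in alive Om X t `&` exitC)
          \int[lebesgue_rV R n]_(x in Om `&` A)
            (f x (exit_location Om X w) (fine (exit_time Om X w)))%:E].

End densities.

Section bridge.
Context (R : realType) (n : nat).
(* fF x t stands for f^F(x, t; x0, 0), fB x t xT T for f^B(x, t; xT, T). *)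
Variables (Om : set 'rV[R]_n) (fF : 'rV[R]_n -> R -> R)
  (fB : 'rV[R]_n -> R -> 'rV[R]_n -> R -> R).

Definition bridge (x : 'rV[R]_n) (t : R) (xT : 'rV[R]_n) (T : R) : R :=
  fF x t * fB x t xT T / fF xT T.

Definition bridge_converges :=
  forall x t y T, Om x -> boundary Om y -> 0 < t < T ->
    cvg (bridge x t xT T @[xT --> within Om (nbhs y)]).

Definition bridge_exit (x : 'rV[R]_n) (t : R) (y : 'rV[R]_n) (T : R) : R :=
  lim (bridge x t xT T @[xT --> within Om (nbhs y)]).

End bridge.

(* g f allows the exchange of integration and expectation: the hypotheses of
   the Fubini-Tonelli theorem for (w, t, x) |-> g(x, t) f(x, t; Y(w), T(w)) and
   the product measure dP dt dx on {0 < t < T(w), x in Om}. *)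
Definition exchange_allowed (R : realType) (n : nat) d (S : measurableType d)
    (P : probability S R) (Om : set 'rV[R]_n) (X : R -> S -> 'rV[R]_n)
    (g : 'rV[R]_n -> R -> R) (f : 'rV[R]_n -> R -> 'rV[R]_n -> R -> R) :=
  let dom := [set p : S * (R * 'rV[R]_n) |
    lifespan Om X p.1 p.2.1 /\ Om p.2.2] in
  let h := fun p : S * (R * 'rV[R]_n) =>
    (g p.2.2 p.2.1 * f p.2.2 p.2.1 (exit_location Om X p.1)
                         (fine (exit_time Om X p.1)))%:E in
  measurable_fun dom h /\
  ((forall x t, Om x -> 0 < t -> 0 <= g x t) \/
   (prod_measure P (prod_measure lebesgue_measure (lebesgue_rV R n))).-integrable
     dom h).

(* Main.v *)
Require Import Defs.
From HB Require Import structures.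
From mathcomp Require Import all_boot all_order all_algebra.
From mathcomp Require Import finmap.
From mathcomp Require Import all_classical all_reals all_analysis.
From mathcomp Require Import measurable_realfun.
Set Implicit Arguments.
Unset Strict Implicit.
Unset Printing Implicit Defensive.
Import Order.TTheory GRing.Theory Num.Theory.
Import numFieldNormedType.Exports.
Local Open Scope classical_set_scope.
Local Open Scope ring_scope.

(** The formula is the tower property of conditional expectation. The limiting
    bridge density f(x, t; y, T) is, for each t, a conditional density of the
    killed process at time t given its exit pair (y, T). Hence, for nonnegative g
    and fixed t, the expectation of g (X t, t) over the trajectories alive at t
    equals the expectation, over the same trajectories, of the integral of
    g(x, t) f(x, t; exit pair) over Om (expectation_given_exit). Integrating over
    t and exchanging the integrals with Tonelli's theorem gives the formula
    (ge0_expectation_given_exit). The signed case is the difference of the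
    formulas for the two parts of g, which are finite when the integrand is
    integrable (expectation_integral_given_exit).

    Two technical points carry most of the work.

    The conditional density is given through the probabilities of events. It is
    extended to integrals of nonnegative functions by simple approximation
    (ge0_integral_disintegration).

    Tonelli's theorem needs joint measurability in the trajectory and in time.
    It follows from the continuity of the paths for the process itself
    (measurable_continuous_process), and from a compactness argument for the exit
    time (measurable_alive). Continuity also gives that the exit location is on
    the boundary (exit_location_boundary), which is where the conditional density
    is constrained.

    Trajectories that never exit have no exit pair; they are null, and the
    integrals are compared on the others (ae_eq_iterated_integral). *)

(** * Borel sets of Euclidean space and continuous processes *)

Section euclidean_borel.
Context (R : realType) (n : nat).

(** Open sets are countable unions of cubes with rational centres, and cubes are
    coordinate boxes: hence the sigma-algebra generated by the coordinates
    contains the Borel sets. *)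
Lemma open_measurable_rV (A : set 'rV[R]_n) : open A -> measurable A.
Proof.
move=> oA.
pose c (q : 'rV[rat]_n) : 'rV[R]_n := map_mx ratr q.
pose B (p : 'rV[rat]_n * nat) :=
  if `[< ball (c p.1) p.2.+1%:R^-1 `<=` A >] then
    [set v : 'rV[R]_n | forall i, ball (c p.1 ord0 i) p.2.+1%:R^-1 (v ord0 i)]
  else set0.
have -> : A = \bigcup_p B p.
  apply/seteqP; split=> [v Av|v [p _]]; last first.
    rewrite /B; case: ifPn => // /asboolP sA pv; apply: sA; split=> [//|i j].
    by rewrite ord1; exact: pv.
  have /nbhs_ballP[e /= e0 eA] : nbhs v A by exact: open_nbhs_nbhs.
  have [m me] : exists m, m.+1%:R^-1 < e / 2.
    have : e / 2 > 0 by rewrite divr_gt0.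
    by move=> /ltr_add_invr[m]; rewrite add0r => ?; exists m.
  have m0 : 0 < m.+1%:R^-1 :> R by rewrite invr_gt0.
  have /fin_all_exists[q qv] (i : 'I_n) :
      exists q : rat, ball (v ord0 i) m.+1%:R^-1 (ratr q : R).
    have vB : ball (v ord0 i) m.+1%:R^-1 !=set0.
      by exists (v ord0 i); exact: ballxx.
    have [x [vx [q _ qx]]] := @dense_rat R _ vB (ball_open _ _).
    by exists q; rewrite qx.
  have qvi i : ball (c (\row_i q i) ord0 i) m.+1%:R^-1 (v ord0 i).
    by rewrite !mxE; apply: ball_sym.
  exists (\row_i q i, m) => //; rewrite /B/= ifT//; apply/asboolP => u qu; apply: eA.
  apply: (@le_ball _ _ _ (m.+1%:R^-1 + m.+1%:R^-1)).
    by rewrite (splitr e) lerD// ltW.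
  apply: ball_triangle qu; split=> // i j; rewrite ord1; exact: ball_sym.
apply: countable_bigcupT_measurable => [|p]; first exact: countableP.
rewrite /B; case: ifPn => // _.
apply: (@measurable_rV_box R n (fun i => ball (c p.1 ord0 i) p.2.+1%:R^-1)) => i.
by apply: open_measurable; exact: ball_open.
Qed.

Lemma closed_measurable_rV (A : set 'rV[R]_n) : closed A -> measurable A.
Proof.
by move=> /closed_openC/open_measurable_rV mA; rewrite -(setCK A); exact: measurableC.
Qed.

Lemma measurable_boundary (A : set 'rV[R]_n) : measurable (boundary A).
Proof.
apply: measurableD; first by apply: closed_measurable_rV; exact: closed_closure.
by apply: open_measurable_rV; exact: open_interior.
Qed.

End euclidean_borel.

Lemma cvg_floor_grid (R : realType) (t : R) :
  (Num.floor (t * m.+1%:R))%:~R / m.+1%:R @[m --> \oo] --> t.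
Proof.
apply: (@squeeze_cvgr _ _ _ _ (fun m => t - m.+1%:R^-1) (cst t)).
- near=> m; have m0 : 0 < m.+1%:R :> R by [].
  rewrite ler_pdivlMr// ler_pdivrMr// mulrBl mulVf ?lt0r_neq0//.
  rewrite lerBlDr -[X in _ + X]/(1%:~R) -intrD ltW ?floorD1_gt//=.
  by rewrite /cst floor_le.
- rewrite -[X in _ --> X]subr0; apply: cvgB; first exact: cvg_cst.
  exact: cvg_harmonic.
- exact: cvg_cst.
Unshelve. all: by end_near. Qed.

(** Measurability in each variable is not enough for joint measurability; with
    continuity in time, the process is the limit of its values at the grid times
    floor (t (m + 1)) / (m + 1), which are countably many. *)
Lemma measurable_continuous_process d (T : measurableType d) (R : realType) n
    (Y : R -> T -> 'rV[R]_n) :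
  (forall t, measurable_fun [set: T] (Y t)) -> (forall w, continuous (Y ^~ w)) ->
  measurable_fun [set: T * R] (fun p => Y p.2 p.1).
Proof.
move=> mY cY; apply: measurable_fun_rV => i.
pose h m (p : T * R) :=
  Y ((Num.floor (p.2 * m.+1%:R))%:~R / m.+1%:R) p.1 ord0 i.
apply: (@measurable_fun_cvg _ _ _ _ h).
  move=> m _ B mB; rewrite setTI.
  have -> : h m @^-1` B = \bigcup_(k : int)
      (((fun w => Y (k%:~R / m.+1%:R) w ord0 i) @^-1` B) `*`
       [set t | Num.floor (t * m.+1%:R) = k]).
    apply/seteqP; split=> [[w t] /= Bwt|[w t] [k _ [/= Bw tk]]]; last by rewrite /h/= tk.
    by exists (Num.floor (t * m.+1%:R)).
  apply: countable_bigcupT_measurable => [|k]; first exact: countableP.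
  apply: measurableX.
    rewrite -[X in measurable X]setTI.
    exact: (measurableT_comp (@measurable_rV_coord R n i) (mY _)).
  rewrite [X in measurable X](_ : _ = `[k%:~R / m.+1%:R, (k + 1)%:~R / m.+1%:R[%classic)//.
  have m0 : 0 < m.+1%:R :> R by [].
  apply/seteqP; split=> t /=; rewrite in_itv/= ler_pdivrMr// ltr_pdivlMr//.
    by move=> <-; rewrite floor_itv.
  by move=> ?; apply/eqP; rewrite floor_eq.
move=> [w t] _; rewrite /h/=.
have cYi : continuous (fun s => Y s w ord0 i).
  by move=> s; apply: (@continuous_comp _ _ _ (Y ^~ w) (fun v : 'rV[R]_n => v ord0 i));
    [exact: cY|exact: coord_continuous].
apply: (@cvg_comp _ _ _ _ (fun s => Y s w ord0 i)); last exact: cYi.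
exact: cvg_floor_grid.
Qed.

(** * The exit time *)

(** Freezing a path before time 0 makes it continuous on the whole line, where
    continuity is easier to use than relative to a half-line. *)
Lemma continuous_extend_left (R : realType) (U : topologicalType) (f : R -> U) :
  {within `[0, +oo[, continuous f} -> continuous (fun t : R => f (Num.max t 0)).
Proof.
move=> /subspace_continuousP cf t.
have ge0 s : `[0, +oo[%classic (Num.max s 0 : R).
  by rewrite /= in_itv/= andbT le_max lexx orbT.
apply: (@cvg_comp _ _ _ (fun s : R => Num.max s 0 : R) f (nbhs t)
  (within `[0, +oo[%classic (nbhs (Num.max t 0 : R)))).
  move=> A; rewrite nbhs_simpl/= /within/= => nA.
  have cm : continuous (fun s : R => Num.max s 0).
    by move=> s; apply: continuous_max; [exact: cvg_id|exact: cvg_cst].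
  have := cm t _ nA; rewrite nbhs_simpl/=.
  by apply: filterS => s; apply; exact: ge0.
exact: cf.
Qed.

Section exit_time_of_a_continuous_path.
Context (R : realType) (n : nat) d (S : measurableType d).
Variables (Om : set 'rV[R]_n) (X : R -> S -> 'rV[R]_n).
Hypothesis Om_open : open Om.
Hypothesis X0_in : forall w, Om (X 0 w).
Hypothesis X_cont : forall w, {within `[0, +oo[, continuous (X ^~ w)}.
Hypothesis X_meas : forall t, 0 <= t -> measurable_fun [set: S] (X t).

Definition nonneg_time_process t w := X (Num.max t 0) w.
Local Notation Y := nonneg_time_process.

Lemma nonneg_time_processE t w : 0 <= t -> Y t w = X t w.
Proof. by move=> t0; rewrite /Y max_l. Qed.

Lemma continuous_nonneg_time_process w : continuous (Y ^~ w).
Proof. exact: (continuous_extend_left (X_cont (w := w))). Qed.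

Lemma measurable_nonneg_time_process :
  measurable_fun [set: S * R] (fun p => Y p.2 p.1).
Proof.
apply: measurable_continuous_process; last exact: continuous_nonneg_time_process.
by move=> t; apply: X_meas; rewrite le_max lexx orbT.
Qed.

Lemma exit_time_ge0 w : (0 <= exit_time Om X w)%E.
Proof. by apply: le_ereal_inf_tmp => _ [t [t0 _] <-]; rewrite lee_fin. Qed.

(** The strict comparison of the exit time with t corresponds to the closed
    interval [0, t], because the set of times at which a continuous path is
    outside the open set Om is closed. *)
Lemma aliveP (t : R) w : 0 <= t ->
  alive Om X t w <-> forall s, 0 <= s <= t -> Om (X s w).
Proof.
move=> t0; rewrite /alive/=; split=> [tT s /andP[s0 st]|Om_t].
  apply: contrapT => Xs; move: tT; rewrite ltNge => /negP; apply.
  apply: (@le_trans _ _ s%:E); last by rewrite lee_fin.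
  by apply: ereal_inf_lbound; exists s.
(* Om is open: the path stays in Om for a short while after t *)
have : \forall s \near t, Om (Y s w).
  apply: continuous_nonneg_time_process.
  by apply: open_nbhs_nbhs; split=> //; rewrite nonneg_time_processE//; apply: Om_t; rewrite t0/=.
move=> /nbhs_ballP[e /= e0 eOm].
apply: (@lt_le_trans _ _ (t + e)%:E); first by rewrite lte_fin ltrDl.
apply: le_ereal_inf_tmp => _ [s [s0 Xs] <-]; rewrite lee_fin leNgt; apply/negP => ste.
apply: Xs; have [st|ts] := leP s t; first by apply: Om_t; rewrite s0.
rewrite -nonneg_time_processE//; apply: eOm => /=.
by rewrite /ball/= ltr_distlC ste andbT (le_lt_trans _ ts)// lerBlDr lerDl ltW.
Qed.

Lemma alive0 w : alive Om X 0 w.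
Proof.
apply/aliveP => // s; rewrite andbC => s0.
by have -> : s = 0 by apply/eqP; rewrite eq_le.
Qed.

Lemma alive_in (t : R) w : 0 <= t -> alive Om X t w -> Om (X t w).
Proof. by move=> t0 /aliveP; apply=> //; rewrite t0/=. Qed.

(** The exit location is a limit of the positions before the exit time, which are
    in Om. It is not in Om itself: otherwise aliveP would make the exit time
    larger than itself. *)
Lemma exit_location_boundary w :
  (exit_time Om X w < +oo)%E -> boundary Om (exit_location Om X w).
Proof.
rewrite /exit_location => Too; set T := fine _.
have TE : exit_time Om X w = T%:E.
  by rewrite fineK// ge0_fin_numE// exit_time_ge0.
have T0 : 0 < T by have := alive0 w; rewrite /alive/= TE lte_fin.
have before s : 0 <= s < T -> Om (X s w).
  move=> /andP[s0 sT]; apply: alive_in => //.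
  by rewrite /alive/= TE lte_fin.
split.
  move=> A; rewrite -[X T w]nonneg_time_processE ?ltW// => nA.
  have /nbhs_ballP[e /= e0 eA] := continuous_nonneg_time_process nA.
  pose s := Num.max 0 (T - e / 2).
  have sT : s < T by rewrite /s gt_max T0 gtrDl oppr_lt0 divr_gt0.
  have s0 : 0 <= s by rewrite /s le_max lexx.
  exists (X s w); split; first by apply: before; rewrite s0.
  rewrite -nonneg_time_processE//; apply: eA.
  rewrite /ball/= ltr_distlC (lt_trans sT) ?ltrDl// andbT.
  by rewrite /s lt_max ltrD2l ltrN2 gtr_pMr// invf_lt1 ?ltr1n ?orbT.
move=> /interior_subset XT.
suff : alive Om X T w by rewrite /alive/= TE ltxx.
apply/aliveP; rewrite ?ltW// => s /andP[s0].
by rewrite le_eqVlt => /predU1P[-> //|sT]; apply: before; rewrite s0.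
Qed.

(** By compactness, a path that stays in the open set Om up to time t keeps a
    positive distance from the complement. To be at distance at least some
    constant is a closed condition, so it need only hold at rational times.
    This writes the event as a countable combination of measurable ones. *)
Lemma measurable_alive (t : R) : measurable (alive Om X t).
Proof.
have [t0|t0] := ltP t 0.
  rewrite (_ : alive _ _ _ = setT)//; apply/seteqP; split=> // w _.
  by rewrite /alive/=; apply: lt_le_trans (exit_time_ge0 w); rewrite lte_fin.
pose C m := [set v : 'rV[R]_n | ball v m.+1%:R^-1 `<=` Om].
have C_closed m : closed (C m).
  rewrite -openC openE => v /=; rewrite /C/= => /existsNP[u /not_implyP[vu Ou]].
  have : nbhs v (ball u m.+1%:R^-1).
    by apply: open_nbhs_nbhs; split; [exact: ball_open|exact: ball_sym].
  by apply: filterS => v' uv' /(_ u (ball_sym uv')).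
(* clamping to [0, t], so that all of the rationals can serve as times *)
pose c (q : R) := Num.min (Num.max q 0) t.
have c_cont : continuous c.
  move=> q; rewrite /c; apply: (@continuous_min R R (fun q => Num.max q 0) (cst t)); last exact: cvg_cst.
  by apply: continuous_max; [exact: cvg_id|exact: cvg_cst].
have c_itv q : 0 <= c q <= t by rewrite /c le_min le_max lexx orbT t0 ge_min lexx orbT.
have c_id (s : R) : 0 <= s <= t -> c s = s.
  by move=> /andP[s0 st]; rewrite /c max_l// min_l.
have -> : alive Om X t = \bigcup_m \bigcap_(q : rat) (X (c (ratr q)) @^-1` C m).
  apply/seteqP; split=> [w /aliveP Om_t|w [m _ Cm]]; last first.
    apply/aliveP => // s s0t.
    have cYc : continuous (fun q => Y (c q) w).
      move=> q; apply: (@continuous_comp _ _ _ c (Y ^~ w)); first exact: c_cont.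
      exact: continuous_nonneg_time_process.
    have /closure_id Cq := (continuous_closedP _).1 cYc _ (C_closed m).
    suff : C m (Y (c s) w).
      rewrite c_id// nonneg_time_processE; last by case/andP: s0t.
      by apply; exact: ballxx.
    suff : ((fun q => Y (c q) w) @^-1` C m) s by [].
    rewrite Cq => A nA.
    have /nbhs_ballP[e /= e0 eA] := nA.
    have sB : ball s e !=set0 by exists s; exact: ballxx.
    have [q [sq [r _ rq]]] := @dense_rat R _ sB (ball_open _ _).
    exists q; split; last exact: eA.
    rewrite /= -rq nonneg_time_processE; last by case/andP: (c_itv (ratr r)).
    exact: Cm.
  have : \forall m \near \oo, `[0, t]%classic `<=` [set s | C m (Y s w)].
    have /compact_near_coveringP := @segment_compact R 0 t.
    apply => s /= s0t.
    have /nbhs_ballP[e /= e0 eOm] : nbhs (Y s w) Om.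
      move: s0t; rewrite in_itv/= => s0t.
      apply: open_nbhs_nbhs; split=> //; rewrite nonneg_time_processE.
        by apply: Om_t.
      by case/andP: s0t.
    near=> s' m.
    move=> u s'u; apply: eOm.
    rewrite (splitr e); apply: (@ball_triangle _ _ (Y s' w)).
      near: s'; apply: continuous_nonneg_time_process.
      by apply: nbhsx_ballx; rewrite divr_gt0.
    have : m.+1%:R^-1 <= e / 2; last by move=> me; apply: le_ball me _ s'u.
    near: m.
    have e20 : 0 < e / 2 by rewrite divr_gt0.
    have := near_infty_natSinv_lt (PosNum e20).
    by apply: filterS => m /= /ltW.
  move=> [m _ Hm]; exists m => // q _ /=.
  have cq := c_itv (ratr q).
  rewrite -nonneg_time_processE; last by case/andP: cq.
  by apply: Hm => /=.
apply: bigcup_measurable => m _.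
rewrite -(setCK (\bigcap_q _)); apply: measurableC; rewrite setC_bigcap.
apply: bigcupT_measurable_rat => q; apply: measurableC.
rewrite -[X in measurable X]setTI; apply: X_meas => //.
  by case/andP: (c_itv (ratr q)).
exact: closed_measurable_rV.
Unshelve. all: by end_near. Qed.

Lemma measurable_exit_time : measurable_fun [set: S] (exit_time Om X).
Proof.
move=> mS; apply: (measurability _ (ErealGenOInfty.measurableE R)) => //.
move=> _ [_ [t ->] <-]; rewrite setTI preimage_itvoy.
exact: measurable_alive.
Qed.

Lemma measurable_exit_location : measurable_fun [set: S] (exit_location Om X).
Proof.
have mT : measurable_fun [set: S] (fine \o exit_time Om X).
  by apply: measurableT_comp measurable_exit_time; exact: fine_measurable.
have -> : exit_location Om X =
    (fun p : S * R => Y p.2 p.1) \o (fun w => (w, fine (exit_time Om X w))).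
  apply/funext => w; rewrite /= nonneg_time_processE// fine_ge0//.
  exact: exit_time_ge0.
apply: measurableT_comp measurable_nonneg_time_process _.
exact: measurable_fun_pair.
Qed.

End exit_time_of_a_continuous_path.

(** * Iterated integrals and conditional densities *)

Section iterated_integrals.
Local Open Scope ereal_scope.
Context d1 d2 (T1 : measurableType d1) (T2 : measurableType d2) (R : realType).
Variables (m1 : {sigma_finite_measure set T1 -> \bar R})
  (m2 : {sigma_finite_measure set T2 -> \bar R}).

(** By definition the integral is the difference of those of the positive and
    negative parts, infinite values included, and each of these is measurable by
    Tonelli's theorem. *)
Lemma measurable_integral_snd (f : T1 * T2 -> \bar R) :
  measurable_fun [set: T1 * T2] f ->
  measurable_fun [set: T1] (fun x => \int[m2]_y f (x, y)).
Proof.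
move=> mf.
have -> : (fun x => \int[m2]_y f (x, y)) =
    (fun x => fubini_F m2 f^\+ x - fubini_F m2 f^\- x).
  apply/funext => x; rewrite /fubini_F [LHS]integralE.
  by congr (_ - _); apply: eq_integral => y _; rewrite ?funeposE ?funenegE.
apply: emeasurable_funB; apply: measurable_fun_fubini_tonelli_F => //.
exact: measurable_funepos.
exact: measurable_funeneg.
Qed.

(** Here k1 and k2 are two nonnegative functions rather than the parts of one
    signed function, because the integral over Om of a signed function is the
    difference of the integrals of its parts, which are not the parts of that
    difference. *)
Lemma iterated_integralB (k1 k2 : T1 * T2 -> \bar R) :
  measurable_fun [set: T1 * T2] k1 -> measurable_fun [set: T1 * T2] k2 ->
  (forall p, 0 <= k1 p) -> (forall p, 0 <= k2 p) ->
  \int[m1]_x \int[m2]_y k1 (x, y) < +oo ->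
  \int[m1]_x \int[m2]_y k2 (x, y) < +oo ->
  \int[m1]_x \int[m2]_y (k1 (x, y) - k2 (x, y)) =
  \int[m1]_x \int[m2]_y k1 (x, y) - \int[m1]_x \int[m2]_y k2 (x, y).
Proof.
have ik k : measurable_fun [set: T1 * T2] k -> (forall p, 0 <= k p) ->
    \int[m1]_x \int[m2]_y k (x, y) < +oo -> (m1 \x m2).-integrable setT k.
  move=> mk k0 koo; apply/integrableP; split=> //.
  under eq_integral do rewrite gee0_abs//.
  by rewrite fubini_tonelli1.
move=> mk1 mk2 k10 k20 k1oo k2oo.
have i1 := ik _ mk1 k10 k1oo.
have i2 := ik _ mk2 k20 k2oo.
have := integral12_prod_meas1 (integrableB measurableT i1 i2).
rewrite /fubini_F => ->.
by rewrite integralB// !fubini_tonelli1.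
Qed.

End iterated_integrals.

Section disintegration.
Import HBNNSimple.
Local Open Scope ereal_scope.
Context d d' (T : measurableType d) (V : measurableType d') (R : realType).
Variables (P : {measure set T -> \bar R}) (m : {measure set V -> \bar R}).
Variables (E : set T) (D : set V) (Z : T -> V) (f : T -> V -> R).
Hypotheses (mE : measurable E) (mD : measurable D).
Hypothesis mZ : measurable_fun E Z.
Hypothesis mf : forall w, E w -> measurable_fun D (f w).
Hypothesis f_ge0 : forall w, E w -> forall x, D x -> (0 <= f w x)%R.
Hypothesis mker : forall A, measurable A ->
  measurable_fun E (fun w => \int[m]_(x in D `&` A) (f w x)%:E).
Hypothesis density : forall A, measurable A ->
  P (E `&` Z @^-1` A) = \int[P]_(w in E) \int[m]_(x in D `&` A) (f w x)%:E.

Let integral_indic_density w (A : set V) (a : R) : E w -> (0 <= a)%R -> measurable A ->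
  \int[m]_(x in D) ((a * \1_A x)%:E * (f w x)%:E) =
  a%:E * \int[m]_(x in D `&` A) (f w x)%:E.
Proof.
move=> Ew a0 mA.
rewrite integral_mkcondr epatch_indic -ge0_integralZl//.
- by apply: eq_integral => x _; rewrite EFinM -muleA [X in _ * X]muleC.
- apply: emeasurable_funM; apply/measurable_EFinP; first exact: mf.
  exact: measurable_funTS.
- by move=> x Dx; rewrite mule_ge0// lee_fin//; exact: f_ge0.
Qed.

Let nnsfun_disintegration (s : {nnsfun V >-> R}) :
  measurable_fun E (fun w => \int[m]_(x in D) ((s x)%:E * (f w x)%:E)) /\
  \int[P]_(w in E) (s (Z w))%:E =
  \int[P]_(w in E) \int[m]_(x in D) ((s x)%:E * (f w x)%:E).
Proof.
pose r : seq R := fset_set (range s).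
pose A i := s @^-1` [set r`_i].
have sE x : s x = (\sum_(i < size r) (r`_i * \1_(A i) x))%R by exact: fimfunEord.
have mA i : measurable (A i) by exact: measurable_funPTI.
have r_ge0 (i : 'I_(size r)) : (0 <= r`_i)%R.
  have : r`_i \in fset_set (range s) by exact: mem_nth.
  by rewrite in_fset_set// inE => -[x _ <-].
have inner w : E w -> \int[m]_(x in D) ((s x)%:E * (f w x)%:E) =
    \sum_(i < (size r)) (r`_i)%:E * \int[m]_(x in D `&` A i) (f w x)%:E.
  move=> Ew.
  under [RHS]eq_bigr do rewrite -integral_indic_density//.
  rewrite -ge0_integral_sum//.
  - apply: eq_integral => x; rewrite inE => Dx.
    rewrite sE -sumEFin ge0_sume_distrl//.
    by move=> i _; rewrite lee_fin mulr_ge0.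
  - move=> i; apply: emeasurable_funM; apply/measurable_EFinP; last exact: mf.
    by apply: measurable_funM => //; exact: measurable_funTS.
  - by move=> i x Dx; rewrite mule_ge0// lee_fin ?mulr_ge0//; exact: f_ge0.
have mterm (i : 'I_(size r)) : measurable_fun E
    (fun w => (r`_i)%:E * \int[m]_(x in D `&` A i) (f w x)%:E).
  by apply: measurable_funeM; exact: mker.
have mindZ i : measurable_fun E (fun w => \1_(A i) (Z w) : R).
  by apply: measurableT_comp mZ; exact: measurable_indic.
have ker_ge0 w i : E w -> 0 <= \int[m]_(x in D `&` A i) (f w x)%:E.
  by move=> Ew; apply: integral_ge0 => x [Dx _]; rewrite lee_fin; exact: f_ge0.
split.
  apply: (eq_measurable_fun (fun w => \sum_(i < (size r)) (r`_i)%:E *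
      \int[m]_(x in D `&` A i) (f w x)%:E)).
    by move=> w /set_mem Ew; rewrite inner.
  exact: emeasurable_sum.
under [RHS]eq_integral => w /set_mem Ew do rewrite inner//.
rewrite ge0_integral_sum//; last first.
  by move=> i w Ew; rewrite mule_ge0 ?ker_ge0// lee_fin.
under eq_integral do rewrite sE -sumEFin.
rewrite ge0_integral_sum//.
- apply: eq_bigr => i _.
  rewrite [RHS]ge0_integralZl//; [|exact: mker|by move=> w Ew; exact: ker_ge0|by rewrite lee_fin].
  rewrite -density//; under eq_integral do rewrite EFinM.
  rewrite ge0_integralZl//; last 2 first.
  + exact/measurable_EFinP/mindZ.
  + by rewrite lee_fin.
  have mEA : measurable (E `&` Z @^-1` A i) by exact: mZ.
  rewrite -[in RHS](setIidl (@subIsetl _ E (Z @^-1` A i))) -integral_indic//.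
  congr (_ * _); apply: eq_integral => w Ew.
  by rewrite !indicE in_setI Ew.
- move=> i; apply/measurable_EFinP; apply: measurable_funM => //; exact: mindZ.
- by move=> i w Ew; rewrite lee_fin mulr_ge0.
Qed.

(** The conditional density extends from events to nonnegative functions:
    by linearity to simple functions, then by monotone convergence. *)
Lemma ge0_integral_disintegration (phi : V -> \bar R) :
  measurable_fun [set: V] phi -> (forall x, 0 <= phi x) ->
  \int[P]_(w in E) phi (Z w) =
  \int[P]_(w in E) \int[m]_(x in D) (phi x * (f w x)%:E).
Proof.
move=> mphi phi0.
pose s := nnsfun_approx measurableT mphi.
have s_nd x : {homo (fun n => (s n x)%:E) : a b / (a <= b)%N >-> a <= b}.
  by move=> a b ab; rewrite lee_fin; exact/lefP/nd_nnsfun_approx.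
have s_cvg x : (s n x)%:E @[n --> \oo] --> phi x.
  exact: cvg_nnsfun_approx.
have lhs : \int[P]_(w in E) (s n (Z w))%:E @[n --> \oo] --> \int[P]_(w in E) phi (Z w).
  under [X in _ --> X]eq_integral do rewrite -(cvg_lim _ (s_cvg _))//.
  apply: (cvg_monotone_convergence mE (g' := fun n w => (s n (Z w))%:E)) => //.
  - by move=> n; apply/measurable_EFinP; apply: measurableT_comp mZ.
  - by move=> n w _; rewrite lee_fin.
have mprod n w : E w -> measurable_fun D (fun x => (s n x)%:E * (f w x)%:E).
  move=> Ew; apply: emeasurable_funM; apply/measurable_EFinP; last exact: mf.
  exact: measurable_funTS.
have prod_ge0 n w x : E w -> D x -> 0 <= (s n x)%:E * (f w x)%:E.
  by move=> Ew Dx; rewrite mule_ge0// lee_fin//; exact: f_ge0.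
have prod_nd w x : E w -> D x ->
    {homo (fun n => (s n x)%:E * (f w x)%:E) : a b / (a <= b)%N >-> a <= b}.
  move=> Ew Dx a b ab; rewrite lee_wpmul2r ?s_nd// lee_fin; exact: f_ge0.
have inner_cvg w : E w ->
    \int[m]_(x in D) ((s n x)%:E * (f w x)%:E) @[n --> \oo] -->
    \int[m]_(x in D) (phi x * (f w x)%:E).
  move=> Ew; have -> : \int[m]_(x in D) (phi x * (f w x)%:E) =
      \int[m]_(x in D) limn (fun n => (s n x)%:E * (f w x)%:E).
    apply: eq_integral => x _; apply/esym/cvg_lim => //.
    by apply: cvgeZr => //; exact: s_cvg.
  apply: (cvg_monotone_convergence mD
      (g' := fun n x => (s n x)%:E * (f w x)%:E)) => //.
  - by move=> n; exact: mprod.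
  - by move=> n x Dx; exact: prod_ge0.
  - by move=> x Dx; exact: prod_nd.
have inner_nd w : E w ->
    {homo (fun n => \int[m]_(x in D) ((s n x)%:E * (f w x)%:E)) :
       a b / (a <= b)%N >-> a <= b}.
  move=> Ew a b ab; apply: ge0_le_integral => //.
  - by move=> x Dx; exact: prod_ge0.
  - exact: mprod.
  - exact: mprod.
  - by move=> x Dx; exact: prod_nd.
have rhs : \int[P]_(w in E) \int[m]_(x in D) ((s n x)%:E * (f w x)%:E) @[n --> \oo] -->
    \int[P]_(w in E) \int[m]_(x in D) (phi x * (f w x)%:E).
  under [X in _ --> X]eq_integral => w /set_mem Ew do rewrite -(cvg_lim _ (inner_cvg _ Ew))//.
  apply: (cvg_monotone_convergence mE
    (g' := fun n w => \int[m]_(x in D) ((s n x)%:E * (f w x)%:E))) => //.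
  - by move=> n; case: (nnsfun_disintegration (s n)).
  - move=> n w Ew; apply: integral_ge0 => x Dx.
    by rewrite mule_ge0// lee_fin//; exact: f_ge0.
move: lhs; under eq_fun do rewrite (nnsfun_disintegration _).2.
by move=> lhs; exact: cvg_unique lhs rhs.
Qed.

End disintegration.

(** * The killed process and its exit pair *)

Section killed_process.
Local Open Scope ereal_scope.
Context (R : realType) (n : nat) d (S : measurableType d) (P : probability S R).
Variables (Om : set 'rV[R]_n) (X : R -> S -> 'rV[R]_n).
Hypothesis Om_open : open Om.
Hypothesis X0_in : forall w, Om (X 0%R w).
Hypothesis X_cont : forall w, {within `[0%R, +oo[, continuous (X ^~ w)}.
Hypothesis X_meas : forall t : R, (0 <= t)%R -> measurable_fun [set: S] (X t).
Hypothesis exit_finite : {ae P, forall w, exit_time Om X w < +oo}.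
Variable f : 'rV[R]_n -> R -> 'rV[R]_n -> R -> R.
Hypothesis f_density : forall t : R, (0 < t)%R ->
  density_given_exit P Om X t (fun x y T => f x t y T).

Local Notation mu := (@lebesgue_measure R).
Local Notation m := (lebesgue_rV R n).
Local Notation tau w := (fine (exit_time Om X w)).
Local Notation Y := (nonneg_time_process X).

Definition exits : set S := [set w | exit_time Om X w < +oo].

(** The integrands below carry a set W of trajectories: the whole space for the
    integrals of the theorem, and exits where the density is known to be
    nonnegative. *)
Definition path_domain (W : set S) : set (S * R) :=
  [set p | W p.1 /\ lifespan Om X p.1 p.2].

Definition bridge_domain (W : set S) : set (S * (R * 'rV[R]_n)) :=
  [set p | W p.1 /\ (lifespan Om X p.1 p.2.1 /\ Om p.2.2)].

Definition path_integrand (W : set S) (g : 'rV[R]_n -> R -> R) : S * R -> \bar R :=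
  (fun p => (g (X p.2 p.1) p.2)%:E) \_ (path_domain W).

Definition bridge_product (g : 'rV[R]_n -> R -> R) (p : S * (R * 'rV[R]_n)) : \bar R :=
  (g p.2.2 p.2.1 * f p.2.2 p.2.1 (exit_location Om X p.1) (tau p.1))%:E.

Definition bridge_integrand (W : set S) (g : 'rV[R]_n -> R -> R) :
    S * (R * 'rV[R]_n) -> \bar R :=
  bridge_product g \_ (bridge_domain W).

Let mOm : measurable Om. Proof. exact: open_measurable_rV. Qed.

Let mtau : measurable_fun [set: S] (exit_time Om X).
Proof. exact: measurable_exit_time. Qed.

Lemma measurable_exits : measurable exits.
Proof.
rewrite -[X in measurable X]setTI.
exact: measurable_lte.
Qed.

Lemma measurable_path_domain W : measurable W -> measurable (path_domain W).
Proof.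
move=> mW.
have -> : path_domain W = (W `*` `]0%R, +oo[%classic) `&`
    [set p : S * R | p.2%:E < exit_time Om X p.1].
  apply/seteqP; split=> -[w t] /=; rewrite /path_domain/= /lifespan/= /alive/= in_itv/= andbT.
    by move=> [? []].
  by move=> [[]].
apply: measurableI; first exact: measurableX.
rewrite -[X in measurable X]setTI; apply: measurable_lte => //.
  by apply/measurable_EFinP; exact: measurable_snd.
by apply: measurableT_comp mtau _; exact: measurable_fst.
Qed.

Lemma measurable_bridge_domain W : measurable W -> measurable (bridge_domain W).
Proof.
move=> mW.
have -> : bridge_domain W =
    (fun p : S * (R * 'rV[R]_n) => (p.1, p.2.1)) @^-1` (path_domain W) `&`
    (fun p : S * (R * 'rV[R]_n) => p.2.2) @^-1` Om.
  apply/seteqP; split=> -[w [t x]] /=; rewrite /path_domain/bridge_domain/=.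
    by move=> [? []].
  by move=> [[]].
apply: measurableI; rewrite -[X in measurable X]setTI.
  have mp : measurable_fun setT (fun p : S * (R * 'rV[R]_n) => (p.1, p.2.1)).
    apply: measurable_fun_pair; first exact: measurable_fst.
    by apply: measurableT_comp; [exact: measurable_fst|exact: measurable_snd].
  by apply: mp => //; exact: measurable_path_domain.
have mp : measurable_fun setT (fun p : S * (R * 'rV[R]_n) => p.2.2).
  by apply: measurableT_comp; [exact: measurable_snd|exact: measurable_snd].
exact: mp.
Qed.

Lemma ae_eq_iterated_integral (k1 k2 : S * R -> \bar R) :
  measurable_fun [set: S * R] k1 -> measurable_fun [set: S * R] k2 ->
  (forall w t, exits w -> k1 (w, t) = k2 (w, t)) ->
  \int[P]_w \int[mu]_t k1 (w, t) = \int[P]_w \int[mu]_t k2 (w, t).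
Proof.
move=> mk1 mk2 k12; apply: ae_eq_integral => //.
- exact: (measurable_integral_snd mu mk1).
- exact: (measurable_integral_snd mu mk2).
apply: filterS exit_finite => w Ww _.
by apply: eq_integral => t _; exact: k12.
Qed.

Section integrand.
Variable g : 'rV[R]_n -> R -> R.
Hypothesis mg : measurable_fun (Om `*` [set t : R | (0 < t)%R])
  (fun p : 'rV[R]_n * R => g p.1 p.2).

(* extending g by 0 gives a function that composes with the whole process *)
Let G : 'rV[R]_n * R -> \bar R :=
  (fun p => (g p.1 p.2)%:E) \_ (Om `*` [set t : R | (0 < t)%R]).

Let mG : measurable_fun [set: 'rV[R]_n * R] G.
Proof.
have mD : measurable (Om `*` [set t : R | (0 < t)%R]).
  apply: measurableX => //.
  rewrite (_ : [set t : R | _] = `]0%R, +oo[%classic)//.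
  by apply/seteqP; split=> t /=; rewrite in_itv/= andbT.
by apply: (measurable_restrictT _ mD).1; exact/measurable_EFinP.
Qed.

Let GE x (t : R) : Om x -> (0 < t)%R -> G (x, t) = (g x t)%:E.
Proof. by move=> Ox t0; rewrite /G patchE ifT// inE. Qed.

Lemma measurable_path_integrand W : measurable W ->
  measurable_fun [set: S * R] (path_integrand W g).
Proof.
move=> mW; apply: (measurable_restrictT _ (measurable_path_domain mW)).1.
apply: (eq_measurable_fun (G \o (fun p : S * R => (Y p.2 p.1, p.2)))).
  move=> [w t] /set_mem[/= _ [t0 aw]].
  rewrite nonneg_time_processE ?ltW// GE//.
  by apply: alive_in aw => //; exact: ltW.
apply: measurableT_comp mG _; apply: measurable_funTS.
apply: measurable_fun_pair; last exact: measurable_snd.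
exact: measurable_nonneg_time_process.
Qed.

Lemma measurable_bridge_integrand W : measurable W ->
  measurable_fun (bridge_domain W) (bridge_product g) ->
  measurable_fun [set: S * (R * 'rV[R]_n)] (bridge_integrand W g).
Proof.
by move=> mW; apply: (measurable_restrictT _ (measurable_bridge_domain mW)).1.
Qed.

Lemma measurable_bridge_integral W : measurable W ->
  measurable_fun (bridge_domain W) (bridge_product g) ->
  measurable_fun [set: S * R]
    (fun p => \int[m]_x bridge_integrand W g (p.1, (p.2, x))).
Proof.
move=> mW mgf.
apply: (measurable_integral_snd m (f := fun p : (S * R) * 'rV[R]_n =>
  bridge_integrand W g (p.1.1, (p.1.2, p.2)))).
apply: measurableT_comp (measurable_bridge_integrand mW mgf) _.
apply: measurable_fun_pair.
  by apply: measurableT_comp; exact: measurable_fst.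
apply: measurable_fun_pair; last exact: measurable_snd.
by apply: measurableT_comp; [exact: measurable_snd|exact: measurable_fst].
Qed.

Lemma integral_path_integrand W w : W w ->
  \int[mu]_(t in lifespan Om X w) (g (X t w) t)%:E =
  \int[mu]_t path_integrand W g (w, t).
Proof.
move=> Ww; rewrite integral_mkcond; apply: eq_integral => t _.
rewrite /path_integrand !patchE/=; congr (if _ then _ else _).
by apply/idP/idP => /set_mem h; apply/mem_set; [split|case: h].
Qed.

Lemma integral_bridge_integrand W w : W w ->
  \int[mu]_(t in lifespan Om X w)
     \int[m]_(x in Om) (g x t * f x t (exit_location Om X w) (tau w))%:E =
  \int[mu]_t \int[m]_x bridge_integrand W g (w, (t, x)).
Proof.
move=> Ww; rewrite integral_mkcond; apply: eq_integral => t _.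
rewrite patchE; case: ifPn => [/set_mem lt|/negP lt].
  rewrite integral_mkcond; apply: eq_integral => x _.
  rewrite /bridge_integrand !patchE/=; congr (if _ then _ else _).
  by apply/idP/idP => /set_mem h; apply/mem_set; [split|case: h => _ []].
rewrite integral0_eq// => x _; rewrite /bridge_integrand patchE ifF//.
by apply/negP => /set_mem[_ [? _]]; apply: lt; exact/mem_set.
Qed.

Let alive_exits t : (0 < t)%R ->
  alive Om X t `&` [set w | (t < tau w)%R] = alive Om X t `&` exits.
Proof.
move=> t0; apply/seteqP; split=> w [aw] /=; rewrite /exits/=.
  (* fine sends +oo to 0, which is not above t *)
  move=> tT; split=> //; rewrite ltey; apply/eqP => Too.
  by move: tT; rewrite Too /= ltNge ltW.
move=> Too; split=> //; rewrite -lte_fin fineK//.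
by rewrite ge0_fin_numE// exit_time_ge0.
Qed.

(** Here the exit pair lies where the conditional density is constrained: on the
    boundary, and at a time later than t. *)
Lemma bridge_ge0 w t x : bridge_domain exits (w, (t, x)) ->
  (0 <= f x t (exit_location Om X w) (tau w))%R.
Proof.
move=> [/= Ww [[t0 aw] Ox]].
have [+ _ _] := f_density t0.
have ytw : (t < tau w)%R.
  have : (alive Om X t `&` exits) w by [].
  by rewrite -alive_exits// => -[].
have bw : boundary Om (exit_location Om X w) by exact: exit_location_boundary.
by move=> /(_ _ _ bw ytw)[_ /(_ _ Ox)].
Qed.

Hypothesis g_ge0 : forall x t, Om x -> (0 < t)%R -> (0 <= g x t)%R.

(** At a fixed time t, both sides are the expectation of g (X t, t) on survival:
    the right-hand side first conditions on the exit pair, and then averages. *)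
Lemma expectation_given_exit t :
  \int[P]_w path_integrand exits g (w, t) =
  \int[P]_w \int[m]_x bridge_integrand exits g (w, (t, x)).
Proof.
have [t0|t0] := leP t 0%R.
  have dead w : ~ lifespan Om X w t by move=> [/lt_geF]; rewrite t0.
  rewrite [LHS]integral0_eq => [|w _]; last first.
    by rewrite /path_integrand patchE ifF//; apply/negP => /set_mem[_ /dead].
  rewrite [RHS]integral0_eq// => w _; rewrite integral0_eq// => x _.
  by rewrite /bridge_integrand patchE ifF//; apply/negP => /set_mem[_ [/dead]].
have [f_ok mker dens] := f_density t0.
pose E := alive Om X t `&` exits.
have mE : measurable E.
  by apply: measurableI; [exact: measurable_alive|exact: measurable_exits].
have bE w : E w -> boundary Om (exit_location Om X w) /\ (t < tau w)%R.
  move=> Ew; split; first by apply: exit_location_boundary => //; case: Ew.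
  by move: Ew; rewrite /E -alive_exits// => -[].
have mEdens A : measurable A -> P (E `&` X t @^-1` A) =
    \int[P]_(w in E) \int[m]_(x in Om `&` A)
      (f x t (exit_location Om X w) (tau w))%:E.
  move=> mA; rewrite /E -alive_exits//.
  (* this event keeps the trajectories with a finite exit time, among those
     alive at t *)
  apply: (dens A [set u | t < u.2]%R) => //.
  rewrite (_ : [set u | _] = setT `*` `]t, +oo[%classic); first exact: measurableX.
  by apply/seteqP; split=> -[y T] /=; rewrite in_itv/= andbT// => -[].
have phi_ge0 x : 0 <= G (x, t).
  rewrite /G patchE; case: ifPn => // /set_mem[/= Ox _].
  by rewrite lee_fin g_ge0.
have := @ge0_integral_disintegration _ _ _ _ R P m E Om (X t)
  (fun w x => f x t (exit_location Om X w) (tau w)) mE mOm _ _ _ _ _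
  (fun x => G (x, t)) _ phi_ge0.
move=> dis; transitivity (\int[P]_(w in E) G (X t w, t)).
  rewrite [RHS]integral_mkcond; apply: eq_integral => w _.
  rewrite /path_integrand !patchE/=; case: ifPn => [/set_mem[/= Ww [_ aw]]|].
    by rewrite ifT ?GE//; [apply: alive_in aw => //; exact: ltW|exact/mem_set].
  move=> /negP nw; rewrite ifF//; apply/negP => /set_mem[aw Ww].
  by apply: nw; apply/mem_set.
rewrite dis.
- rewrite integral_mkcond; apply: eq_integral => w _.
  rewrite patchE; case: ifPn => [/set_mem[aw Ww]|/negP nw].
    rewrite integral_mkcond; apply: eq_integral => x _.
    rewrite /bridge_integrand !patchE/=; case: ifPn => [/set_mem Ox|/negP nx].
      by rewrite GE// ifT//; exact/mem_set.
    by rewrite ifF//; apply/negP => /set_mem[_ [_ Ox]]; apply: nx; exact/mem_set.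
  rewrite integral0_eq// => x _; rewrite /bridge_integrand patchE ifF//.
  by apply/negP => /set_mem[/= Ww [[_ aw] _]]; apply: nw; exact/mem_set.
- by apply: measurable_funTS; apply: X_meas; exact: ltW.
- by move=> w /bE[bw tw]; have [] := f_ok _ _ bw tw.
- by move=> w /bE[bw tw]; have [] := f_ok _ _ bw tw.
- move=> A mA.
  have mC : measurable [set u : 'rV[R]_n * R | boundary Om u.1 /\ (t < u.2)%R].
    rewrite (_ : [set u | _] = boundary Om `*` `]t, +oo[%classic).
      by apply: measurableX => //; exact: measurable_boundary.
    by apply/seteqP; split=> -[y T] /=; rewrite in_itv/= andbT.
  apply: (measurable_comp mC _ (mker A mA)
    (g := fun w => (exit_location Om X w, tau w))).
    by move=> _ [w /bE ? <-].
  apply: measurable_funTS; apply: measurable_fun_pair.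
    exact: measurable_exit_location.
  by apply: measurableT_comp mtau; exact: fine_measurable.
- exact: mEdens.
- exact: measurable_fun_pair1.
Qed.

Lemma bridge_integrand_ge0 p : 0 <= bridge_integrand exits g p.
Proof.
move: p => [w [t x]]; rewrite /bridge_integrand patchE/=; case: ifPn => // /set_mem Dp.
rewrite lee_fin mulr_ge0//; last exact: bridge_ge0 Dp.
by case: Dp => _ [[t0 _] Ox]; exact: g_ge0.
Qed.

Lemma path_integrand_ge0 p : 0 <= path_integrand exits g p.
Proof.
move: p => [w t]; rewrite /path_integrand patchE/=; case: ifPn => // /set_mem[_ [t0 aw]].
by rewrite lee_fin g_ge0//; apply: alive_in aw => //; exact: ltW.
Qed.

(** Tonelli moves the time integral outermost on both sides. *)
Lemma ge0_expectation_given_exit :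
  measurable_fun (bridge_domain exits) (bridge_product g) ->
  \int[P]_w \int[mu]_t path_integrand exits g (w, t) =
  \int[P]_w \int[mu]_t \int[m]_x bridge_integrand exits g (w, (t, x)).
Proof.
move=> mgf; have mex := measurable_exits.
rewrite (fubini_tonelli (m1 := P) (m2 := mu) _
  (measurable_path_integrand mex) path_integrand_ge0).
rewrite (fubini_tonelli (m1 := P) (m2 := mu) _ (measurable_bridge_integral mex mgf)); last first.
  by move=> p; apply: integral_ge0 => x _; exact: bridge_integrand_ge0.
by apply: eq_integral => t _; exact: expectation_given_exit.
Qed.

End integrand.

Lemma ge0_iterated_integral3 (h : S * (R * 'rV[R]_n) -> \bar R) :
  measurable_fun [set: S * (R * 'rV[R]_n)] h -> (forall p, 0 <= h p) ->
  \int[P]_w \int[mu]_t \int[m]_x h (w, (t, x)) =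
  \int[prod_measure P (prod_measure mu m)]_p h p.
Proof.
move=> mh h0.
have -> : \int[prod_measure P (prod_measure mu m)]_p h p =
    \int[P]_w \int[prod_measure mu m]_q h (w, q).
  exact: (fubini_tonelli1 (m1 := P) (m2 := prod_measure mu m) _ mh h0).
apply: eq_integral => w _; apply/esym.
apply: (fubini_tonelli1 (m1 := mu) (m2 := m) (fun q => h (w, q))) => //.
exact: measurable_fun_pair2.
Qed.

(** A signed g is split into its parts gp and gn. The conditional density is
    nonnegative, so the parts of g * f are gp * f and gn * f; the integrability
    of g * f thus bounds the iterated integrals of the parts, first on the bridge
    side, and then on the path side by the nonnegative case. *)
Lemma expectation_integral_given_exit (g : 'rV[R]_n -> R -> R) :
  measurable_fun (Om `*` [set t : R | (0 < t)%R])
    (fun p : 'rV[R]_n * R => g p.1 p.2) ->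
  exchange_allowed P Om X g f ->
  \int[P]_w \int[mu]_(t in lifespan Om X w) (g (X t w) t)%:E =
  \int[P]_w \int[mu]_(t in lifespan Om X w)
    \int[m]_(x in Om) (g x t * f x t (exit_location Om X w) (tau w))%:E.
Proof.
move=> mg [mgf exch].
have domT : [set p : S * (R * 'rV[R]_n) | lifespan Om X p.1 p.2.1 /\ Om p.2.2] =
    bridge_domain setT.
  by apply/seteqP; split=> p //= [].
move: mgf exch; rewrite domT -/(bridge_product g) => mgf exch.
have mex := measurable_exits.
have mgf_exits : measurable_fun (bridge_domain exits) (bridge_product g).
  apply: measurable_funS mgf; first exact: measurable_bridge_domain.
  by move=> p [].
under eq_integral do rewrite (integral_path_integrand g (W := setT))//.
under [RHS]eq_integral do rewrite (integral_bridge_integrand g (W := setT))//.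
rewrite (@ae_eq_iterated_integral (path_integrand setT g) (path_integrand exits g)); last 3 first.
- exact: measurable_path_integrand.
- exact: measurable_path_integrand.
- move=> w t Ww; rewrite /path_integrand !patchE; congr (if _ then _ else _).
  by apply/idP/idP => /set_mem[_ h]; exact/mem_set.
rewrite (@ae_eq_iterated_integral
  (fun p => \int[m]_x bridge_integrand setT g (p.1, (p.2, x)))
  (fun p => \int[m]_x bridge_integrand exits g (p.1, (p.2, x)))); last 3 first.
- exact: measurable_bridge_integral.
- exact: measurable_bridge_integral.
- move=> w t Ww; apply: eq_integral => x _.
  rewrite /bridge_integrand !patchE; congr (if _ then _ else _).
  by apply/idP/idP => /set_mem[_ h]; exact/mem_set.
case: exch => [g_ge0|/integrableP[_ gf_fin]].
  exact: ge0_expectation_given_exit.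
pose gp x t : R := Num.max (g x t) 0%R.
pose gn x t : R := Num.max (- g x t)%R 0%R.
have gp_ge0 x t : (0 <= gp x t)%R by rewrite le_max lexx orbT.
have gn_ge0 x t : (0 <= gn x t)%R by rewrite le_max lexx orbT.
have gE x t : g x t = (gp x t - gn x t)%R.
  rewrite /gp /gn; have /orP[g0|g0] := le_total 0%R (g x t).
    by rewrite max_l// max_r ?subr0// oppr_le0.
  by rewrite max_r// max_l ?opprK ?add0r// oppr_ge0.
have mgp : measurable_fun (Om `*` [set t : R | (0 < t)%R])
    (fun p : 'rV[R]_n * R => gp p.1 p.2).
  exact: measurable_maxr.
have mgn : measurable_fun (Om `*` [set t : R | (0 < t)%R])
    (fun p : 'rV[R]_n * R => gn p.1 p.2).
  by apply: measurable_maxr => //; exact: measurableT_comp.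
have mgpf : measurable_fun (bridge_domain exits) (bridge_product gp).
  apply: eq_measurable_fun (measurable_funepos mgf_exits).
  move=> [w [t x]] /set_mem/bridge_ge0 f0.
  by rewrite funeposE /bridge_product/= -EFin_max maxr_pMl// mul0r.
have mgnf : measurable_fun (bridge_domain exits) (bridge_product gn).
  apply: eq_measurable_fun (measurable_funeneg mgf_exits).
  move=> [w [t x]] /set_mem/bridge_ge0 f0.
  by rewrite funenegE /bridge_product/= -EFin_max maxr_pMl// mul0r mulNr.
have fin (g' : 'rV[R]_n -> R -> R) : (forall x t, 0 <= g' x t)%R -> (forall x t, g' x t <= `|g x t|)%R ->
    measurable_fun (bridge_domain exits) (bridge_product g') ->
    \int[P]_w \int[mu]_t \int[m]_x bridge_integrand exits g' (w, (t, x)) < +oo.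
  move=> g'_ge0 g'_le mg'f; rewrite ge0_iterated_integral3; last 2 first.
  - exact: measurable_bridge_integrand.
  - by move=> p; exact: bridge_integrand_ge0.
  apply: le_lt_trans gf_fin; rewrite [leRHS]integral_mkcond.
  apply: ge0_le_integral => //.
  - by move=> p _; exact: bridge_integrand_ge0.
  - exact: measurable_bridge_integrand.
  - apply: (measurable_restrictT _ (measurable_bridge_domain measurableT)).1.
    exact: measurableT_comp.
  - move=> [w [t x]] _; rewrite /bridge_integrand patchE; case: ifPn => [/set_mem Dp|_].
      rewrite patchE ifT; last by apply/mem_set; case: Dp.
      rewrite /bridge_product/= lee_fin normrM ler_pM//; first exact: bridge_ge0 Dp.
      by rewrite ler_norm.
    rewrite patchE; case: ifPn => // _; exact: abse_ge0.
have gp_le x t : (gp x t <= `|g x t|)%R by rewrite ge_max ler_norm/=.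
have gn_le x t : (gn x t <= `|g x t|)%R by rewrite ge_max -normrN ler_norm/=.
have finp := fin gp gp_ge0 gp_le mgpf.
have finn := fin gn gn_ge0 gn_le mgnf.
have dis (g' : 'rV[R]_n -> R -> R) : (forall x t, 0 <= g' x t)%R ->
    measurable_fun (Om `*` [set t : R | (0 < t)%R])
      (fun p : 'rV[R]_n * R => g' p.1 p.2) ->
    measurable_fun (bridge_domain exits) (bridge_product g') ->
    \int[P]_w \int[mu]_t path_integrand exits g' (w, t) =
    \int[P]_w \int[mu]_t \int[m]_x bridge_integrand exits g' (w, (t, x)).
  by move=> g'_ge0 mg' mg'f; apply: ge0_expectation_given_exit.
transitivity (\int[P]_w \int[mu]_t
    (path_integrand exits gp (w, t) - path_integrand exits gn (w, t))).
  apply: eq_integral => w _; apply: eq_integral => t _.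
  rewrite /path_integrand !patchE; case: ifPn => _; last by rewrite sube0.
  by rewrite /= -EFinB -gE.
transitivity (\int[P]_w \int[mu]_t
    (\int[m]_x bridge_integrand exits gp (w, (t, x)) -
     \int[m]_x bridge_integrand exits gn (w, (t, x)))); last first.
  apply: eq_integral => w _; apply: eq_integral => t _.
  rewrite [RHS]integralE; congr (_ - _); apply: eq_integral => x _.
    rewrite funeposE /bridge_integrand !patchE; case: ifPn => [/set_mem/bridge_ge0 f0|_].
      by rewrite /bridge_product/= -EFin_max maxr_pMl// mul0r.
    by rewrite maxxx.
  rewrite funenegE /bridge_integrand !patchE; case: ifPn => [/set_mem/bridge_ge0 f0|_].
    by rewrite /bridge_product/= -EFin_max maxr_pMl// mul0r mulNr.
  by rewrite oppe0 maxxx.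
have disp := dis gp gp_ge0 mgp mgpf.
have disn := dis gn gn_ge0 mgn mgnf.
have Kge0 (g' : 'rV[R]_n -> R -> R) p : (forall x t, 0 <= g' x t)%R ->
    0 <= \int[m]_x bridge_integrand exits g' (p.1, (p.2, x)).
  by move=> g'_ge0; apply: integral_ge0 => x _; exact: bridge_integrand_ge0.
have lhs := @iterated_integralB _ _ _ _ R P mu
  (path_integrand exits gp) (path_integrand exits gn)
  (measurable_path_integrand mgp mex) (measurable_path_integrand mgn mex)
  (path_integrand_ge0 (fun x t _ _ => gp_ge0 x t))
  (path_integrand_ge0 (fun x t _ _ => gn_ge0 x t)).
have rhs := @iterated_integralB _ _ _ _ R P mu
  (fun p => \int[m]_x bridge_integrand exits gp (p.1, (p.2, x)))
  (fun p => \int[m]_x bridge_integrand exits gn (p.1, (p.2, x)))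
  (measurable_bridge_integral mex mgpf) (measurable_bridge_integral mex mgnf)
  (Kge0 gp ^~ gp_ge0) (Kge0 gn ^~ gn_ge0) finp finn.
rewrite rhs lhs ?disp ?disn//.
Qed.

End killed_process.

Theorem theorem2p1 (R : realType) (n k : nat)
  (Om : set 'rV[R]_n)
  (Om_open : open Om) (Om_connected : connected Om) (Om_bounded : bounded_set Om)
  (mu : 'rV[R]_n -> R -> 'rV[R]_n) (sigma : 'rV[R]_n -> R -> 'M[R]_(n, k))
  (* the Ito process and its killing at the boundary of Om *)
  (d : measure_display) (S : measurableType d) (P : probability S R)
  (F : R -> set (set S)) (W : R -> S -> 'rV[R]_k)
  (x0 : 'rV[R]_n) (X : R -> S -> 'rV[R]_n)
  (F_filtration : filtration F)
  (W_wiener : wiener_process P F W)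
  (x0_in : Om x0)
  (X_ito : ito_process P F W mu sigma x0 X)
  (exit_finite : {ae P, forall w, (exit_time Om X w < +oo)%E})
  (* solutions of the Kolmogorov problems, and transition densities *)
  (fF : 'rV[R]_n -> R -> R)
  (fB : 'rV[R]_n -> R -> 'rV[R]_n -> R -> R)
  (fF_solution : forward_solution mu (diffusion_tensor sigma) Om x0 fF)
  (fB_solution : forall (xT : 'rV[R]_n) (T : R), Om xT -> 0 < T ->
     backward_solution mu (diffusion_tensor sigma) Om xT T
       (fun x t => fB x t xT T))
  (fF_density : forward_transition_density P Om X fF)
  (fB_density : backward_transition_density P F Om X fB)
  (* the limiting bridge density is the density given the exit pair *)
  (bridge_cvg : bridge_converges Om fF fB)
  (bridge_density : forall t : R, 0 < t ->
     density_given_exit P Om X t (fun x y T => bridge_exit Om fF fB x t y T))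
  (g : 'rV[R]_n -> R -> R)
  (g_measurable : measurable_fun (Om `*` [set t : R | 0 < t])
     (fun p : 'rV[R]_n * R => g p.1 p.2))
  (g_bridge_finite : forall (t : R) (y : 'rV[R]_n) (T : R),
     boundary Om y -> 0 < t < T ->
     (lebesgue_rV R n).-integrable Om
       (fun x => (g x t * bridge_exit Om fF fB x t y T)%:E))
  (g_exchange : exchange_allowed P Om X g (bridge_exit Om fF fB)) :
  (\int[P]_w \int[lebesgue_measure]_(t in lifespan Om X w) (g (X t w) t)%:E =
   \int[P]_w \int[lebesgue_measure]_(t in lifespan Om X w)
     \int[lebesgue_rV R n]_(x in Om)
       (g x t * bridge_exit Om fF fB x t (exit_location Om X w)
                  (fine (exit_time Om X w)))%:E)%E.
Proof.
have [X0 X_cont X_adapted _ _] := X_ito.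
apply: (@expectation_integral_given_exit _ _ _ _ _ _ _ Om_open _ X_cont) => //.
- by move=> w; rewrite X0.
- move=> t t0 _ A mA; rewrite setTI.
  by have [_] := F_filtration.1 t t0; apply; exact: X_adapted.
Qed.
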